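(* Let $F$ be a field and let $m\ge 1$. If $n\ge 3$, then $$H_1(C_{n,m},\mathbb Z)=\bigoplus_{i=1}^m \mathfrak{sl}_n(F).$$ When $n=2$, assume further that $\operatorname{char} F\neq 2$ and $F\neq \mathbb F_3$. Then $$H_1(C_{2,m},\mathbb Z)=\bigoplus_{i=1}^m\mathfrak{sl}_2(F).$$
   Context: $C_{n,m}$ denotes the kernel of the reduction homomorphism $SL_n(F[[t_1,\dots,t_m]])\to SL_n(F)$ modulo the maximal ideal $(t_1,\dots,t_m)$, i.e. the group of matrices in $SL_n(F[[t_1,\dots,t_m]])$ congruent to the identity modulo $(t_1,\dots,t_m)$. $\mathfrak{sl}_n(F)$ is the additive group of trace-zero $n\times n$ matrices over $F$. Equality means isomorphism of abelian groups; homology is group homology of the discrete group. *)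

(* Defs.v *)
From HB Require Import structures.
From mathcomp Require Import all_boot all_order all_algebra.
From mathcomp Require Import boolp.
From mathcomp Require Import freeg mpoly.

Set Implicit Arguments.
Unset Strict Implicit.
Unset Printing Implicit Defensive.

Import GRing.Theory.

Local Open Scope ring_scope.

(* Formal power series in m variables: a family of coefficients indexed by
   multi-exponents. The wrapper keeps the Cauchy product apart from the
   pointwise ring structure on functions. *)
Record mfps (m : nat) (R : comNzRingType) :=
  MFPS { mfps_coef :> 'X_{1..m} -> R }.

Section PowerSeries.
Variables (m : nat) (R : comNzRingType).
Implicit Types (f g h : mfps m R) (a : 'X_{1..m}).

HB.instance Definition _ := [isNew for (@mfps_coef m R)].
HB.instance Definition _ := [Choice of mfps m R by <:].

Lemma mfpsP f g : f =1 g -> f = g.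
Proof. by case: f g => [f] [g] /= /funext ->. Qed.

Definition mfps_zero : mfps m R := MFPS (fun _ => 0).
Definition mfps_opp f : mfps m R := MFPS (fun a => - f a).
Definition mfps_add f g : mfps m R := MFPS (fun a => f a + g a).
Definition mfps_one : mfps m R := MFPS (fun a => (a == 0%MM)%:R).

(* Cauchy product; the degree bound only makes the index type finite, since
   a = b + c forces mdeg b, mdeg c <= mdeg a. *)
Definition mfps_mul f g : mfps m R := MFPS (fun a =>
  \sum_(bc : 'X_{1..m < (mdeg a).+1, (mdeg a).+1} | a == (bc.1 + bc.2)%MM)
     f bc.1 * g bc.2).

Lemma mfps_addA : associative mfps_add.
Proof. by move=> f g h; apply: mfpsP => a /=; rewrite addrA. Qed.
Lemma mfps_addC : commutative mfps_add.
Proof. by move=> f g; apply: mfpsP => a /=; rewrite addrC. Qed.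
Lemma mfps_add0 : left_id mfps_zero mfps_add.
Proof. by move=> f; apply: mfpsP => a /=; rewrite add0r. Qed.
Lemma mfps_addN : left_inverse mfps_zero mfps_opp mfps_add.
Proof. by move=> f; apply: mfpsP => a /=; rewrite addNr. Qed.

HB.instance Definition _ := GRing.isZmodule.Build (mfps m R)
  mfps_addA mfps_addC mfps_add0 mfps_addN.

Definition mfps_trunc d f : {mpoly R[m]} :=
  \sum_(b : 'X_{1..m < d}) f b *: 'X_[b].

Lemma mfps_truncE d f a :
  (mfps_trunc d f)@_a = if (mdeg a < d)%N then f a else 0.
Proof.
rewrite /mfps_trunc raddf_sum /=; case: ltnP => had.
  rewrite (bigD1 (BMultinom had)) //= mcoeffZ mcoeffX eqxx mulr1.
  rewrite big1 ?addr0 // => b nb; rewrite mcoeffZ mcoeffX.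
  by rewrite -[_ == a]/(b == BMultinom had) (negbTE nb) mulr0.
rewrite big1 // => b _; rewrite mcoeffZ mcoeffX; case: eqP => [eb|_].
  by move: (bmdeg b); rewrite eb ltnNge had.
by rewrite mulr0.
Qed.

Lemma mfps_mulE d f g a : (mdeg a < d)%N ->
  mfps_mul f g a = (mfps_trunc d f * mfps_trunc d g)@_a.
Proof.
move=> had; rewrite mcoeffM /=; apply: eq_bigr => -[b c] _ /=.
by rewrite !mfps_truncE !(leq_trans (bmdeg _)).
Qed.

Lemma mcoeffM_low (p p' q q' : {mpoly R[m]}) d a : (mdeg a < d)%N ->
  (forall b, (mdeg b < d)%N -> p@_b = p'@_b) ->
  (forall b, (mdeg b < d)%N -> q@_b = q'@_b) -> (p * q)@_a = (p' * q')@_a.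
Proof.
move=> had hp hq; rewrite !mcoeffM; apply: eq_bigr => -[b c] _ /=.
by rewrite hp ?hq ?(leq_trans (bmdeg _)).
Qed.

Lemma mfps_mulA : associative mfps_mul.
Proof.
move=> f g h; apply: mfpsP => a; set d := (mdeg a).+1.
have had : (mdeg a < d)%N by [].
have tM f1 g1 b : (mdeg b < d)%N ->
    (mfps_trunc d (mfps_mul f1 g1))@_b = (mfps_trunc d f1 * mfps_trunc d g1)@_b.
  by move=> hb; rewrite mfps_truncE hb (mfps_mulE _ _ hb).
rewrite !(mfps_mulE _ _ had).
rewrite (mcoeffM_low had (fun b _ => erefl) (tM g h)) mulrA.
by rewrite (mcoeffM_low had (tM f g) (fun b _ => erefl)).
Qed.

Lemma mfps_mulC : commutative mfps_mul.
Proof.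
by move=> f g; apply: mfpsP => a; rewrite !(mfps_mulE _ _ (ltnSn _)) mulrC.
Qed.

Lemma mfps_mul1 : left_id mfps_one mfps_mul.
Proof.
move=> f; apply: mfpsP => a; rewrite (mfps_mulE _ _ (ltnSn _)).
have -> : mfps_trunc (mdeg a).+1 mfps_one = 1.
  apply/mpolyP => b; rewrite mfps_truncE mcoeff1 /=.
  by case: ltnP => //; case: eqP => [->|//]; rewrite mdeg0.
by rewrite mul1r mfps_truncE ltnSn.
Qed.

Lemma mfps_mulDl : left_distributive mfps_mul mfps_add.
Proof.
move=> f g h; apply: mfpsP => a /=; rewrite -big_split /=.
by apply: eq_bigr => bc _; rewrite mulrDl.
Qed.

Lemma mfps_one_neq0 : mfps_one != mfps_zero.
Proof.
apply/eqP => /(congr1 (fun f : mfps m R => f 0%MM)) /= /eqP.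
by rewrite eqxx oner_eq0.
Qed.

HB.instance Definition _ := GRing.Zmodule_isComNzRing.Build (mfps m R)
  mfps_mulA mfps_mulC mfps_mul1 mfps_mulDl mfps_one_neq0.

(* Reduction modulo the maximal ideal (t_1, ..., t_m). *)
Definition mfps_const f : R := f 0%MM.

Fact mfps_const_is_zmod_morphism : zmod_morphism mfps_const.
Proof. by []. Qed.

Fact mfps_const_is_monoid_morphism : monoid_morphism mfps_const.
Proof.
split=> [|f g]; first by rewrite /mfps_const /= eqxx.
have h0 : (mdeg (0%MM : 'X_{1..m}) < 1)%N by rewrite mdeg0.
rewrite /mfps_const [LHS](mfps_mulE _ _ h0).
by rewrite (rmorphM (mcoeff 0%MM)) /= !mfps_truncE mdeg0.
Qed.

HB.instance Definition _ := GRing.isZmodMorphism.Build (mfps m R) R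
  mfps_const mfps_const_is_zmod_morphism.
HB.instance Definition _ := GRing.isMonoidMorphism.Build (mfps m R) R
  mfps_const mfps_const_is_monoid_morphism.

End PowerSeries.

Record SL (n : nat) (R : comNzRingType) :=
  MkSL { SLval :> 'M[R]_n; _ : \det SLval == 1 }.

Section SpecialLinearGroup.
Variables (n : nat) (R : comNzRingType).
Implicit Types A B C : SL n R.

HB.instance Definition _ := [isSub for (@SLval n R)].
HB.instance Definition _ := [Choice of SL n R by <:].

Lemma SL_det A : \det A = 1.
Proof. exact/eqP/(valP A). Qed.

Fact SL_one_proof : \det (1%:M : 'M[R]_n) == 1.
Proof. by rewrite det1. Qed.
Definition SL_one : SL n R := MkSL SL_one_proof.

Fact SL_mul_proof A B : \det (A *m B) == 1.
Proof. by rewrite det_mulmx !SL_det mulr1. Qed.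
Definition SL_mul A B : SL n R := MkSL (SL_mul_proof A B).

Fact SL_inv_proof A : \det (\adj A) == 1.
Proof.
have := congr1 determinant (mul_mx_adj A).
by rewrite det_mulmx SL_det det1 mul1r => ->.
Qed.
Definition SL_inv A : SL n R := MkSL (SL_inv_proof A).

Lemma SL_mulA : associative SL_mul.
Proof. by move=> A B C; apply: val_inj; rewrite /= mulmxA. Qed.
Lemma SL_mul1 : left_id SL_one SL_mul.
Proof. by move=> A; apply: val_inj; rewrite /= mul1mx. Qed.
Lemma SL_1mul : right_id SL_one SL_mul.
Proof. by move=> A; apply: val_inj; rewrite /= mulmx1. Qed.
Lemma SL_mulV : left_inverse SL_one SL_inv SL_mul.
Proof. by move=> A; apply: val_inj; rewrite /= mul_adj_mx SL_det. Qed.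
Lemma SL_Vmul : right_inverse SL_one SL_inv SL_mul.
Proof. by move=> A; apply: val_inj; rewrite /= mul_mx_adj SL_det. Qed.

HB.instance Definition _ := isGroup.Build (SL n R)
  SL_mulA SL_mul1 SL_1mul SL_mulV SL_Vmul.

End SpecialLinearGroup.

Section SLMap.
Variables (n : nat) (R S : comNzRingType) (phi : {rmorphism R -> S}).

Fact SL_map_proof (A : SL n R) : \det (map_mx phi A) == 1.
Proof. by rewrite det_map_mx SL_det rmorph1. Qed.
Definition SL_map (A : SL n R) : SL n S := MkSL (SL_map_proof A).

Fact SL_map_is_morphism : monoid.monoid_morphism SL_map.
Proof.
split=> [|A B]; apply: val_inj; first exact: map_mx1.
exact: map_mxM.
Qed.
HB.instance Definition _ :=
  isUMagmaMorphism.Build (SL n R) (SL n S) SL_map SL_map_is_morphism.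

End SLMap.

Arguments SL_map n {R S} phi A.

Record group_ker (G H : groupType) (f : UMagmaMorphism.type G H) :=
  MkGroupKer { group_ker_val :> G; _ : f group_ker_val == 1%g }.

Section GroupKer.
Variables (G H : groupType) (f : UMagmaMorphism.type G H).

HB.instance Definition _ := [isSub for (@group_ker_val G H f)].
HB.instance Definition _ := [Choice of group_ker f by <:].

Fact group_ker_closed : group_closed (fun x : G => f x == 1%g).
Proof.
split=> [|x y]; rewrite -!topredE /= ?gmulf1 //.
by move=> /eqP fx /eqP fy; rewrite gmulfF fx fy divgg.
Qed.
HB.instance Definition _ :=
  SubChoice_isSubGroup.Build G _ (group_ker f) group_ker_closed.

End GroupKer.

Definition congSL (F : fieldType) (n m : nat) : groupType :=
  group_ker (SL_map n (@mfps_const m F)).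

(* Homology of a discrete group with trivial integer coefficients, as the
   homology of the (inhomogeneous, unnormalised) bar complex. *)
Definition bar (G : groupType) (k : nat) := {freeg (k.-tuple G)}.

Section GroupHomology.
Variable G : groupType.

(* With x = [g_1 | ... | g_k+1]:
     face 0 drops g_1, face k+1 drops g_k+1, and for 1 <= i <= k face i
     is [g_1 | ... | g_i g_i+1 | ... | g_k+1].
   Slots are 0-based, so tnth x j is g_j+1. *)
Definition bar_face k (i : 'I_k.+2) (x : k.+1.-tuple G) : k.-tuple G :=
  [tuple let y := tnth x (widen_ord (leqnSn k) j) in
         let z := tnth x (fintype.lift ord0 j) in
         if (j.+1 < i)%N then y else if j.+1 == i :> nat then (y * z)%g else z
  | j < k].

Definition bar_boundaryS k : bar G k.+1 -> bar G k :=
  fglift (fun x : k.+1.-tuple G =>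
    \sum_(i < k.+2) (-1) ^+ i *: (<< bar_face i x >> : bar G k)).

Definition bar_boundary k : bar G k -> bar G k.-1 :=
  match k with
  | 0 => fun=> 0
  | k'.+1 => @bar_boundaryS k'
  end.

Fact bar_boundary_is_zmod_morphism k : zmod_morphism (@bar_boundary k).
Proof.
case: k => [|k] c d; first by rewrite /= subr0.
exact: lift_is_additive.
Qed.
HB.instance Definition _ k := GRing.isZmodMorphism.Build _ _
  (@bar_boundary k) (@bar_boundary_is_zmod_morphism k).

Record bar_cycles k :=
  MkCycle { cycle_val :> bar G k; _ : bar_boundary cycle_val == 0 }.

HB.instance Definition _ k := [isSub for (@cycle_val k)].
HB.instance Definition _ k := [Choice of bar_cycles k by <:].

Fact bar_cycles_closed k : zmod_closed (fun c : bar G k => bar_boundary c == 0).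
Proof.
split=> [|c d]; rewrite -!topredE /= ?raddf0 //.
by move=> /eqP c0 /eqP d0; rewrite raddfB /= c0 d0 subr0.
Qed.
HB.instance Definition _ k :=
  GRing.SubChoice_isSubZmodule.Build (bar G k) _ (bar_cycles k)
    (@bar_cycles_closed k).

Definition bar_boundaries k : {pred bar_cycles k} :=
  fun c => `[< exists b : bar G k.+1, val c = bar_boundary b >].

Fact bar_boundaries_closed k : zmod_closed (@bar_boundaries k).
Proof.
split=> [|c d]; rewrite -!topredE /=.
  by apply/asboolP; exists 0; rewrite GRing.val0 raddf0.
move=> /asboolP[b cb] /asboolP[b' db]; apply/asboolP.
by exists (b - b'); rewrite GRing.valB raddfB cb db.
Qed.
HB.instance Definition _ k :=
  GRing.isZmodClosed.Build (bar_cycles k) (@bar_boundaries k)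
    (@bar_boundaries_closed k).

Definition group_homology k : zmodType := Quotient.quot (@bar_boundaries k).

End GroupHomology.

Record sl (n : nat) (R : comNzRingType) :=
  MkSl { sl_val :> 'M[R]_n; _ : \tr sl_val == 0 }.

Section TraceZero.
Variables (n : nat) (R : comNzRingType).

HB.instance Definition _ := [isSub for (@sl_val n R)].
HB.instance Definition _ := [Choice of sl n R by <:].

Fact sl_closed : zmod_closed (fun A : 'M[R]_n => \tr A == 0).
Proof.
split=> [|A B]; rewrite -!topredE /= ?raddf0 //.
by move=> /eqP A0 /eqP B0; rewrite raddfB /= A0 B0 subr0.
Qed.
HB.instance Definition _ :=
  GRing.SubChoice_isSubZmodule.Build 'M[R]_n _ (sl n R) sl_closed.

End TraceZero.

Definition zmod_iso (U V : zmodType) : Prop :=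
  exists phi : {additive U -> V}, bijective phi.

Definition field_iso (K L : fieldType) : Prop :=
  exists phi : {rmorphism K -> L}, bijective phi.

(* Main.v *)
Require Import Defs.
From HB Require Import structures.
From mathcomp Require Import all_boot all_order all_algebra.
From mathcomp Require Import boolp freeg mpoly ring.

(* Write I for the maximal ideal and C for the congruence group.  The degree-one
   coefficients define a surjective homomorphism from C to the sum of m copies
   of sl_n(F) with kernel the matrices congruent to 1 modulo I^2, so it is
   enough that every homomorphism q from C to an abelian group kills this
   kernel.  By Gaussian elimination the kernel is generated by the x_ij(c) with
   c in I^2 and the diag(u, u^-1) with u in 1 + I^2.  For n >= 3,
   x_ij(ab) = [x_ik(a), x_kj(b)]; for n = 2, when 2 is invertible, x_ij(ab) is a
   commutator of a diagonal matrix and some x_ij(c); and the diagonal matrices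
   are handled by x_ij(a) x_ji(b) = x_ji(b/u) diag(u, u^-1) x_ij(a/u),
   u = 1 + ab. *)

Set Implicit Arguments.
Unset Strict Implicit.
Unset Printing Implicit Defensive.

Import GRing.Theory.

Local Open Scope ring_scope.

(** * Congruence subgroups of an ideal in the radical *)

Section Ideals.
Variable R : comNzRingType.
Implicit Types (I : R -> Prop) (a b c x y : R).

Record is_ideal I : Prop := IsIdeal {
  ideal0 : I 0;
  idealD : forall a b, I a -> I b -> I (a + b);
  idealM : forall a b, I b -> I (a * b) }.

(** For an ideal this says that it lies in the Jacobson radical; it makes every diagonal entry of a
    congruence matrix a unit. *)
Definition in_radical I := forall x, I x -> exists y, (1 + x) * y = 1.

(** Finite sums of products are built one product at a time, so that induction can peel off a single
    [a * b]. *)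
Inductive ideal_sq I : R -> Prop :=
| ideal_sq0 : ideal_sq I 0
| ideal_sqD a b c : I a -> I b -> ideal_sq I c -> ideal_sq I (a * b + c).

Lemma idealN I a : is_ideal I -> I a -> I (- a).
Proof. by move=> hI Ia; rewrite -mulN1r; apply: idealM. Qed.

Lemma ideal_sum I (T : Type) (r : seq T) (P : pred T) (f : T -> R) :
  is_ideal I -> (forall i, P i -> I (f i)) -> I (\sum_(i <- r | P i) f i).
Proof.
by move=> hI hf; apply: big_ind => //; [apply: ideal0|apply: idealD].
Qed.

Lemma ideal_sq_ideal I : is_ideal I -> is_ideal (ideal_sq I).
Proof.
move=> hI; split=> [|a b Ia Ib|a b]; first exact: ideal_sq0.
  elim: Ia => [|x y c Ix Iy _ IH]; first by rewrite add0r.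
  by rewrite -addrA; apply: ideal_sqD.
elim=> [|x y c Ix Iy _ IH]; first by rewrite mulr0; apply: ideal_sq0.
by rewrite mulrDr mulrA; apply: ideal_sqD => //; apply: idealM.
Qed.

Lemma ideal_sq_sub I a : is_ideal I -> ideal_sq I a -> I a.
Proof.
move=> hI; elim=> [|x y c Ix Iy _ IH]; first exact: ideal0.
by apply: idealD => //; apply: idealM.
Qed.

Lemma ideal_sqM I a b : I a -> I b -> ideal_sq I (a * b).
Proof. by move=> Ia Ib; rewrite -[_ * _]addr0; apply: ideal_sqD => //;
  apply: ideal_sq0. Qed.

Lemma in_radicalS I J : (forall x, J x -> I x) -> in_radical I -> in_radical J.
Proof. by move=> sJI hI x /sJI/hI. Qed.

Lemma ideal_unitB1 I x y : is_ideal I -> I x -> (1 + x) * y = 1 -> I (y - 1).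
Proof.
move=> hI Ix xy; rewrite -xy (_ : _ - _ = - y * x); last by ring.
exact: idealM.
Qed.

End Ideals.

(** * Transvections, diagonal matrices and elimination *)

Section Matrices.
Variables (R : comNzRingType) (n : nat).
Implicit Types (I : R -> Prop) (M N : 'M[R]_n) (v w : 'cV[R]_n).
Implicit Types (i j k l : 'I_n).

(** The ideal is a parameter because elimination is run both over the maximal ideal and over its
    square. *)
Definition congr_SL I M := \det M = 1 /\ forall i j, I ((M - 1%:M) i j).

(** Left multiplication by this matrix adds [v i 0] times row [k] to every row [i] at once, so a
    single factor can clear a column. *)
Definition transv k v : 'M[R]_n :=
  \matrix_(i, j) ((i == j)%:R + v i 0 *+ (j == k)).

Definition diag2 k l (u u' : R) : 'M[R]_n :=
  diag_mx (\row_j if j == k then u else if j == l then u' else 1).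

Lemma mul_transvE k v M i j : (transv k v *m M) i j = M i j + v i 0 * M k j.
Proof.
rewrite mxE (eq_bigr (fun s =>
  (i == s)%:R * M s j + (v i 0 * M s j) *+ (s == k))).
  rewrite big_split /= (bigD1 i) //= eqxx mul1r big1 ?addr0; last first.
    by move=> s /negbTE; rewrite eq_sym => ->; rewrite mul0r.
  by rewrite (bigD1 k) //= eqxx big1 ?addr0 // => s /negbTE ->.
by move=> s _; rewrite mxE mulrDl; case: (s == k); rewrite ?mul0r.
Qed.

Lemma mul_diag2E k l u u' M i j : (diag2 k l u u' *m M) i j =
  (if i == k then u else if i == l then u' else 1) * M i j.
Proof. by rewrite mul_diag_mx !mxE. Qed.

Lemma transvD k v w : v k 0 = 0 ->
  transv k (v + w) = transv k w *m transv k v.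
Proof.
move=> vk; apply/matrixP => i j; rewrite mul_transvE !mxE vk mul0rn addr0.
rewrite eq_sym.
by case: (eqVneq j k) => [->|njk]; rewrite ?eqxx ?(negbTE njk) ?mulr1 ?mulr0
  ?addr0 // addrA mulr1n eq_sym.
Qed.

Lemma transv0 k : transv k 0 = 1%:M.
Proof. by apply/matrixP => i j; rewrite !mxE mul0rn addr0. Qed.

Lemma det_transv k v : v k 0 = 0 -> \det (transv k v) = 1.
Proof.
move=> vk; rewrite (expand_det_row _ k) (bigD1 k) //= big1 ?addr0; last first.
  by move=> j njk; rewrite !mxE vk mul0rn eq_sym (negbTE njk) addr0 mul0r.
rewrite mxE eqxx vk mul0rn addr0 mul1r /cofactor addnn -signr_odd odd_double
  mul1r.
rewrite (_ : row' _ _ = 1%:M) ?det1 //; apply/matrixP => i j; rewrite !mxE.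
by rewrite (inj_eq lift_inj) eq_sym [fintype.lift k j == k]eq_sym (negbTE
  (neq_lift _ _)) addr0 eq_sym.
Qed.

Lemma congr_SL_transv I k v : is_ideal I -> v k 0 = 0 ->
  (forall i, I (v i 0)) ->
  congr_SL I (transv k v).
Proof.
move=> hI vk Iv; split=> [|i j]; first exact: det_transv.
rewrite !mxE addrAC subrr add0r; case: (j == k); first exact: Iv.
exact: ideal0.
Qed.

Lemma det_diag2 k l u u' : k != l -> u * u' = 1 -> \det (diag2 k l u u') = 1.
Proof.
move=> nkl uu; rewrite det_diag (bigD1 k) //= (bigD1 l) 1?eq_sym //= !mxE.
rewrite eqxx (eq_sym l) (negbTE nkl) eqxx mulrA uu mul1r big1 // => i.
by rewrite mxE => /andP[/negbTE -> /negbTE ->].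
Qed.

Lemma congr_SL_diag2 I k l u u' : is_ideal I -> k != l -> u * u' = 1 ->
  I (u - 1) -> congr_SL I (diag2 k l u u').
Proof.
move=> hI nkl uu Iu; split=> [|i j]; first exact: det_diag2.
rewrite !mxE; case: (i == j); rewrite ?mulr1n ?mulr0n ?subr0;
  last exact: ideal0.
case: (i == k); first by [].
case: (i == l); last by rewrite subrr; apply: ideal0.
apply: (@ideal_unitB1 _ I (u - 1)) => //.
by rewrite addrC subrK.
Qed.

Lemma congr_SL_mul I M N : is_ideal I -> congr_SL I M -> congr_SL I N ->
  congr_SL I (M *m N).
Proof.
move=> hI [dM IM] [dN IN]; split=> [|i j];
  first by rewrite det_mulmx dM dN mulr1.
have -> : M *m N - 1%:M = (M - 1%:M) *m (N - 1%:M) + (M - 1%:M) + (N - 1%:M).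
  by rewrite mulmxBl !mulmxBr !mulmx1 mul1mx addrAC subrK addrA subrK.
rewrite mxE [X in I (X + _)]mxE; apply: idealD => //; apply: idealD => //.
by rewrite mxE; apply: ideal_sum => // k _; apply: idealM.
Qed.

Lemma congr_SL_sub I J M : (forall x, J x -> I x) -> congr_SL J M ->
  congr_SL I M.
Proof. by move=> sJI [dM IM]; split=> // i j; apply: sJI. Qed.

Lemma congr_SL_one I : is_ideal I -> congr_SL I 1%:M.
Proof. by move=> hI; split=> [|i j]; rewrite ?det1 // subrr mxE;
  apply: ideal0. Qed.

(* Gaussian elimination, column by column: a step adds multiples of the current
   row or scales rows from the current one on, and these rows vanish in the
   columns already cleared. *)
Lemma congr_SL_hom0 I (V : zmodType) (q : 'M[R]_n -> V) :
  is_ideal I -> in_radical I ->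
  (forall M N, congr_SL I M -> congr_SL I N -> q (M *m N) = q M + q N) ->
  (forall k v, v k 0 = 0 -> (forall i, I (v i 0)) -> q (transv k v) = 0) ->
  (forall k l u u', k != l -> u * u' = 1 -> I (u - 1) ->
    q (diag2 k l u u') = 0) ->
  forall M, congr_SL I M -> q M = 0.
Proof.
move=> hI hrad qM qT qD.
have q1 : q 1%:M = 0.
  have := qM _ _ (congr_SL_one hI) (congr_SL_one hI); rewrite mulmx1 => /eqP.
  by rewrite -subr_eq subrr => /eqP.
(* Induction on the number [d] of columns still to be cleared; the first [k] already agree with the
   identity. *)
suff H d : forall k : nat, n = (k + d)%N -> forall M, congr_SL I M ->
    (forall i j, (j < k)%N -> M i j = (i == j)%:R) -> q M = 0.
  by move=> M CM; apply: (H n 0%N _ M CM).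
elim: d => [|d IH] k nk M CM cM.
  rewrite (_ : M = 1%:M) //; apply/matrixP => i j.
  by rewrite cM ?mxE // -[k]addn0 -nk.
have kn : (k < n)%N by rewrite nk addnS ltnS leq_addr.
pose K := Ordinal kn.
have pivot1 N : congr_SL I N -> (forall i j, (j < k)%N ->
  N i j = (i == j)%:R) ->
    N K K = 1 -> q N = 0.
  (* This [v] turns column [K] into that of the identity; [v K 0] vanishes because the pivot is
     1. *)
  move=> CN cN NK; pose v : 'cV[R]_n := \col_i ((i == K)%:R - N i K).
  have vK : v K 0 = 0 by rewrite mxE eqxx NK subrr.
  have Iv i : I (v i 0).
    by rewrite mxE -opprB; apply: idealN => //; have := CN.2 i K; rewrite !mxE.
  have CT := congr_SL_transv hI vK Iv.
  have := qM _ _ CT CN; rewrite qT // add0r => <-.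
  apply: (IH k.+1); first by rewrite nk addnS.
    exact: congr_SL_mul.
  move=> i j; rewrite ltnS leq_eqVlt mul_transvE => /orP[/eqP jk|jk].
    rewrite (_ : j = K); last exact: val_inj.
    by rewrite NK mulr1 mxE addrC subrK.
  rewrite !cN // (_ : (K == j) = false) ?mulr0 ?addr0 //.
  by apply/negP => /eqP jK; rewrite -jK /= ltnn in jk.
case: d nk IH => [|d] nk _.
  (* In the last column no later row can absorb the inverse of the pivot, but the matrix is upper
     triangular and its determinant 1 equals the pivot. *)
  have nk1 : k.+1 = n by rewrite nk addn1.
  apply: pivot1 => //; rewrite -CM.1 -det_tr det_trig.
    rewrite (bigD1 K) //= mxE big1 ?mulr1 // => i niK.
    rewrite mxE cM ?eqxx // ltn_neqAle -ltnS nk1 ltn_ord andbT.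
    by apply: contra niK => /eqP ik; apply/eqP/val_inj.
  apply/is_trig_mxP => i j lij; rewrite mxE cM;
    first by rewrite -val_eqE /= (gtn_eqF lij).
  by rewrite (leq_trans lij) // -ltnS nk1.
have ln : (k.+1 < n)%N by rewrite nk !addnS !ltnS leq_addr.
pose L := Ordinal ln.
have nKL : K != L by rewrite -val_eqE /= neq_ltn ltnSn.
(* Otherwise row [K] is scaled by the inverse [y] of the pivot and the next row [L] by the pivot
   itself, which keeps the determinant 1. *)
have IKK : I (M K K - 1) by have := CM.2 K K; rewrite !mxE eqxx.
have [y py] := hrad _ IKK; have Iy := ideal_unitB1 hI IKK py.
rewrite addrC subrK mulrC in py.
have CD := congr_SL_diag2 hI nKL py Iy.
have := qM _ _ CD CM; rewrite qD // add0r => <-.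
apply: pivot1; first exact: congr_SL_mul.
  move=> i j jk; rewrite mul_diag2E (cM i j) //; case: (eqVneq i j) => [->|];
    last by rewrite mulr0.
  by rewrite -!val_eqE /= (ltn_eqF jk) (ltn_eqF (ltnW jk : j < k.+1)%N) mulr1.
by rewrite mul_diag2E eqxx.
Qed.

(** * Homomorphisms from the congruence group to abelian groups *)

Section Abelianization.
Variables (I : R -> Prop) (V : zmodType) (q : 'M[R]_n -> V).
Hypotheses (hI : is_ideal I) (hrad : in_radical I).
Hypothesis qM : forall M N, congr_SL I M -> congr_SL I N ->
  q (M *m N) = q M + q N.

Lemma hom1 : q 1%:M = 0.
Proof.
have := qM (congr_SL_one hI) (congr_SL_one hI); rewrite mulmx1 => /eqP.
by rewrite -subr_eq subrr => /eqP.
Qed.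

Definition elem_mx i j a := transv j (a *: delta_mx i 0 : 'cV_n).

Lemma elemE i j a k l : elem_mx i j a k l =
  (k == l)%:R + a *+ ((k == i) && (l == j)).
Proof. by rewrite !mxE eqxx andbT; case: (k == i); case: (l == j);
  rewrite ?mulr1 ?mulr0 ?mul0rn. Qed.

Lemma mul_elemE i j a M k l : (elem_mx i j a *m M) k l =
  M k l + (a * M j l) *+ (k == i).
Proof. by rewrite mul_transvE !mxE eqxx andbT; case: (k == i);
  rewrite ?mulr1 ?mulr0 ?mul0r. Qed.

Lemma congr_SL_elem i j a : i != j -> I a -> congr_SL I (elem_mx i j a).
Proof.
move=> nij Ia; apply: congr_SL_transv => // [|k].
  by rewrite !mxE eq_sym (negbTE nij) mulr0.
by rewrite !mxE mulrC; apply: idealM.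
Qed.

Lemma elemD i j a b : i != j ->
  elem_mx i j (a + b) = elem_mx i j a *m elem_mx i j b.
Proof.
move=> nij; rewrite addrC /elem_mx scalerDl transvD //.
by rewrite !mxE eq_sym (negbTE nij) mulr0.
Qed.

(** The Steinberg commutator relation, written without inverses so that the two common factors
    cancel after applying [q]. *)
Lemma elem_comm (i j k : 'I_n) a b : i != j -> i != k -> k != j ->
  elem_mx i k a *m elem_mx k j b =
    elem_mx i j (a * b) *m (elem_mx k j b *m elem_mx i k a).
Proof.
move=> nij nik nkj; apply/matrixP => s t.
rewrite !mul_elemE !elemE !eqxx /=.
rewrite [j == k]eq_sym (negbTE nkj) [j == i]eq_sym (negbTE nij) /=.
rewrite [k == t]eq_sym [j == t]eq_sym.
case: (eqVneq s i) => [->|nsi] /=.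
  rewrite (negbTE nik) /=.
  by case: (t == k); case: (t == j); rewrite /= ?mulr1n ?mulr0n; ring.
by case: (s == k); case: (t == j); rewrite /= ?mulr1n ?mulr0n; ring.
Qed.

(** Conjugation multiplies the entry [b] by [u / u' = u ^+ 2]; the excess over [b] is split off as
    the commutator. *)
Lemma diag2_elem_comm i j u u' b : i != j -> u * u' = 1 ->
  diag2 i j u u' *m elem_mx i j b
    = elem_mx i j ((u ^+ 2 - 1) * b) *m (elem_mx i j b *m diag2 i j u u').
Proof.
move=> nij uu; apply/matrixP => s t.
rewrite mul_diag2E !mul_elemE elemE !mxE !eqxx /= [j == i]eq_sym (negbTE nij)
  /=.
rewrite [j == t]eq_sym.
case: (eqVneq s i) => [->|nsi] /=.
  case: (eqVneq t j) => [->|ntj].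
    rewrite (negbTE nij) /= ?mulr1n ?mulr0n; ring: uu.
  by rewrite /= ?mulr1n ?mulr0n; case: (i == t); rewrite /= ?mulr1n ?mulr0n;
    ring.
case: (eqVneq s j) => [->|nsj] /=; last first.
  by case: (s == t); rewrite /= ?mulr1n ?mulr0n; ring.
by rewrite [j == t]eq_sym; case: (t == j); rewrite /= ?mulr1n ?mulr0n; ring.
Qed.

(** The left side has the 2 by 2 block with rows [(1 + a * b, a)] and [(b, 1)]; the right side is
    its LDU factorization with pivot [1 + a * b]. *)
Lemma elem_elem_LDU i j a b u' : i != j -> (1 + a * b) * u' = 1 ->
  elem_mx i j a *m elem_mx j i b
    = elem_mx j i (b * u') *m
      (diag2 i j (1 + a * b) u' *m elem_mx i j (a * u')).
Proof.
move=> nij uu; apply/matrixP => s t.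
have abu : a * b * u' = 1 - u' by rewrite -uu; ring.
rewrite !mul_elemE !mul_diag2E !elemE !eqxx /=.
rewrite [j == t]eq_sym [i == t]eq_sym.
case: (eqVneq s i) => [->|nsi] /=.
  rewrite (negbTE nij) [i == t]eq_sym.
  case: (eqVneq t i) => [->|nti]; rewrite ?(negbTE nij) /=;
    first by rewrite ?mulr1n ?mulr0n; ring.
  by case: (t == j); rewrite /= ?mulr1n ?mulr0n; ring: abu.
case: (eqVneq s j) => [->|nsj] /=; last by case: (s == t);
  rewrite /= ?mulr1n ?mulr0n; ring.
rewrite [j == t]eq_sym.
case: (eqVneq t i) => [->|nti]; rewrite ?(negbTE nij) /=;
  first by rewrite ?mulr1n ?mulr0n; ring: abu.
by case: (t == j); rewrite /= ?mulr1n ?mulr0n; ring: abu.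
Qed.

Lemma hom_elem_sum i j c : i != j ->
  (forall a b, I a -> I b -> q (elem_mx i j (a * b)) = 0) ->
  ideal_sq I c -> q (elem_mx i j c) = 0.
Proof.
move=> nij qab.
have sub := ideal_sq_sub hI.
elim=> [|a b {}c Ia Ib Ic IH]; first by rewrite /elem_mx scale0r transv0 hom1.
rewrite elemD // qM ?qab ?IH ?addr0 //; apply: congr_SL_elem => //.
  exact: idealM.
exact: sub.
Qed.

(* [x_ij(ab)] is the commutator of [x_ik(a)] and [x_kj(b)]. *)
Lemma hom_elem3 i j a b : (3 <= n)%N -> i != j -> I a -> I b ->
  q (elem_mx i j (a * b)) = 0.
Proof.
move=> n3 nij Ia Ib.
have [k /andP[nik nkj]] : exists k, (i != k) && (k != j).
  suff /existsP[k] : [exists k, k \notin [set i; j]].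
    by rewrite !inE negb_or eq_sym => ?; exists k.
  rewrite -[[exists k, _]]negbK negb_exists; apply/negP => /forallP H.
  have := subset_leq_card (_ : [set: 'I_n] \subset [set i; j]).
  rewrite cardsT card_ord cards2 nij => H1; move: n3; rewrite leqNgt ltnS H1 //.
  by apply/subsetP => k _; rewrite -[_ \in _]negbK.
have Ca := congr_SL_elem nik Ia; have Cb := congr_SL_elem nkj Ib.
have Cab : congr_SL I (elem_mx i j (a * b)) by apply: congr_SL_elem => //;
  apply: idealM.
have /(congr1 q) := elem_comm a b nij nik nkj.
rewrite !qM //; last exact: congr_SL_mul.
by rewrite [q _ + q _ in LHS]addrC -[LHS]add0r => /addIr <-.
Qed.

(* Conjugation by [diag(1 + a, (1 + a)^-1)] multiplies the root subgroup by
   [(1 + a)^2 = 1 + a (2 + a)], and [2 + a] is a unit when 2 is. *)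
Lemma hom_elem2 i j a b (h : R) : 2 * h = 1 -> i != j -> I a -> I b ->
  q (elem_mx i j (a * b)) = 0.
Proof.
move=> h2 nij Ia Ib.
have [u' uu] := hrad Ia.
have [y hy] := hrad (idealM hI h Ia).
(* Since [2 + a = 2 * (1 + h * a)] has inverse [h * y], this [c] is [b] divided by [2 + a]. *)
pose c := h * y * b.
have Ic : I c by apply: idealM.
have -> : a * b = ((1 + a) ^+ 2 - 1) * c.
  rewrite /c; transitivity (a * b * (2 * h * ((1 + h * a) * y))).
    by rewrite h2 hy !mulr1.
  by ring: h2.
have Iu : I (1 + a - 1) by rewrite addrAC subrr add0r.
have CD := congr_SL_diag2 hI nij uu Iu.
have Cc := congr_SL_elem nij Ic.
have Cd : congr_SL I (elem_mx i j (((1 + a) ^+ 2 - 1) * c)).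
  by apply: congr_SL_elem => //; apply: idealM.
have /(congr1 q) := diag2_elem_comm c nij uu.
rewrite !qM //; last exact: congr_SL_mul.
by rewrite [q _ + q _ in LHS]addrC -[LHS]add0r => /addIr <-.
Qed.

Lemma diag2M i j (u u' w w' : R) :
  diag2 i j (u * w) (u' * w') = diag2 i j u u' *m diag2 i j w w'.
Proof.
apply/matrixP => s t; rewrite mul_diag2E !mxE.
case: (s == t); rewrite ?mulr0n ?mulr0 // !mulr1n.
by case: (s == i) => //; case: (s == j) => //; rewrite mulr1.
Qed.

Section ElemKilled.
Hypothesis qab : forall i j a b, i != j -> I a -> I b ->
  q (elem_mx i j (a * b)) = 0.

Lemma hom_elem_sq i j c : i != j -> ideal_sq I c -> q (elem_mx i j c) = 0.
Proof. by move=> nij; apply: hom_elem_sum => // a b; apply: qab. Qed.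

(* [x_ij(a) x_ji(b) = x_ji(b / u) diag(u, u^-1) x_ij(a / u)] with [u = 1 + ab],
   and dividing by [u] changes [a] and [b] by elements of the square of [I]. *)
Lemma hom_diag2_mul i j a b u' : i != j -> I a -> I b ->
  (1 + a * b) * u' = 1 -> q (diag2 i j (1 + a * b) u') = 0.
Proof.
move=> nij Ia Ib uu; have nji : j != i by rewrite eq_sym.
have Iab : I (a * b) by apply: idealM.
have div_u k l x : k != l -> I x ->
  q (elem_mx k l (x * u')) = q (elem_mx k l x).
  move=> nkl Ix; have I2 : ideal_sq I (x * (u' - 1)).
    apply: ideal_sqM => //; exact: ideal_unitB1 uu.
  rewrite -[RHS]addr0 -(hom_elem_sq nkl I2) -qM;
    [|exact: congr_SL_elem|by apply: congr_SL_elem => //;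
      apply: ideal_sq_sub I2].
  by rewrite -elemD // mulrBr mulr1 addrC subrK.
have Ib' : I (b * u') by rewrite mulrC; apply: idealM.
have Ia' : I (a * u') by rewrite mulrC; apply: idealM.
have Ca := congr_SL_elem nij Ia; have Cb := congr_SL_elem nji Ib.
have Ca' := congr_SL_elem nij Ia'; have Cb' := congr_SL_elem nji Ib'.
have Iu : I (1 + a * b - 1) by rewrite addrAC subrr add0r.
have CD := congr_SL_diag2 hI nij uu Iu.
have /(congr1 q) := elem_elem_LDU nij uu.
rewrite !qM //; last exact: congr_SL_mul.
rewrite !div_u // addrCA [q _ + q _ in LHS]addrC => H.
apply: (addIr (q (elem_mx j i b) + q (elem_mx i j a))); by rewrite add0r -H.
Qed.

(* [1 + (ab + c) = (1 + c) (1 + a (b / (1 + c)))] reduces the units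
   congruent to 1 modulo the square of [I] to those of the form [1 + ab]. *)
Lemma hom_diag2 i j u u' :
  i != j -> u * u' = 1 -> ideal_sq I (u - 1) -> q (diag2 i j u u') = 0.
Proof.
move=> nij; rewrite -[u](addrNK 1) addrC; move: (u - 1) => {}u uu.
rewrite addrAC subrr add0r => Iu; elim: Iu u' uu => [|a b c Ia Ib Ic IH] u' uu.
  have -> : u' = 1 by rewrite -uu addr0 mul1r.
  have := hom_diag2_mul nij (ideal0 hI) (ideal0 hI); rewrite mulr0; apply.
  by rewrite addr0 mulr1.
have [y cy] := hrad (ideal_sq_sub hI Ic).
have Iby : I (b * y) by rewrite mulrC; apply: idealM.
have cy' : c * y = 1 - y by rewrite -cy; ring.
have e1 : 1 + (a * b + c) = (1 + c) * (1 + a * (b * y)) by ring: cy'.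
have w1 : (1 + a * (b * y)) * ((1 + c) * u') =
  1 by rewrite mulrA [_ * (1 + c)]mulrC -e1.
have -> : u' = y * ((1 + c) * u') by rewrite mulrA [y * _]mulrC cy mul1r.
rewrite e1 diag2M qM ?IH ?hom_diag2_mul ?addr0 //.
  apply: congr_SL_diag2 => //; rewrite addrAC subrr add0r; exact: ideal_sq_sub.
apply: congr_SL_diag2 => //; rewrite addrAC subrr add0r; exact: idealM.
Qed.

(** A transvection is the product of the elementary matrices given by the entries of [v], and [q]
    kills each of them. *)
Lemma hom_transv k v : v k 0 = 0 -> (forall i, ideal_sq I (v i 0)) ->
  q (transv k v) = 0.
Proof.
move=> vk Iv; have hI2 := ideal_sq_ideal hI; have sub := ideal_sq_sub hI.
have -> : v = \sum_i v i 0 *: delta_mx i 0.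
  by rewrite [LHS]matrix_sum_delta; apply: eq_bigr => i _; rewrite big_ord1.
pose P (w : 'cV_n) := [/\ w k 0 =
  0, forall i, ideal_sq I (w i 0) & q (transv k w) = 0].
suff [] : P (\sum_i v i 0 *: delta_mx i 0) by [].
apply: (big_ind P) => [|w x [wk Iw qw] [xk Ix qx]|i _].
- by split=> [|i|]; rewrite ?mxE ?transv0 ?hom1 //; apply: ideal0.
- split=> [|i|]; rewrite ?mxE ?wk ?xk ?addr0 //; first exact: idealD.
  rewrite transvD // qM ?qw ?qx ?addr0 //; apply: congr_SL_transv => // i;
    exact: sub.
case: (eqVneq i k) => [->|nik].
  rewrite vk scale0r.
  by split=> [|j|]; rewrite ?mxE ?transv0 ?hom1 //; apply: ideal0.
split=> [|j|]; last by rewrite (_ : transv _ _ =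
  elem_mx i k (v i 0)) ?hom_elem_sq.
  by rewrite !mxE eq_sym (negbTE nik) mulr0.
by rewrite !mxE mulrC; apply: idealM.
Qed.

(** Elimination over the square of [I] only produces generators on which [q] is already known to
    vanish. *)
Lemma hom_congr_SL_sq0 M : congr_SL (ideal_sq I) M -> q M = 0.
Proof.
have hI2 := ideal_sq_ideal hI; have sub := ideal_sq_sub hI.
apply: congr_SL_hom0 => //.
- exact: in_radicalS hrad.
- by move=> A B CA CB; apply: qM; apply: congr_SL_sub;
  [exact: sub| |exact: sub|].
- exact: hom_transv.
- by move=> *; apply: hom_diag2.
Qed.

End ElemKilled.
End Abelianization.
End Matrices.

(** * Power series *)

Section PowerSeriesIdeal.
Variables (m : nat) (R : comNzRingType).
Implicit Types (f g : mfps m R) (a b c : 'X_{1..m}) (i k : 'I_m) (d e : nat).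

Lemma mfps_coefM f g a : (f * g) a =
  \sum_(bc : 'X_{1..m < (mdeg a).+1, (mdeg a).+1} | a == (bc.1 + bc.2)%MM)
     f bc.1 * g bc.2.
Proof. by []. Qed.

Lemma mfps_coef_sum (T : Type) (r : seq T) (P : pred T) (F : T -> mfps m R) a :
  (\sum_(x <- r | P x) F x) a = \sum_(x <- r | P x) F x a.
Proof. by elim/big_rec2: _ => // x y z _ <-. Qed.

Definition aug_ideal f : Prop := mfps_const f = 0.

Lemma aug_ideal_ideal : is_ideal aug_ideal.
Proof.
split=> [|f g|f g]; rewrite /aug_ideal ?rmorph0 //.
  by move=> f0 g0; rewrite rmorphD /= f0 g0 addr0.
by move=> f0; rewrite rmorphM /= f0 mulr0.
Qed.

Definition lin_coef k f : R := f U_(k)%MM.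

Fact lin_coef_is_zmod_morphism k : zmod_morphism (lin_coef k).
Proof. by []. Qed.
HB.instance Definition _ k := GRing.isZmodMorphism.Build (mfps m R) R
  (lin_coef k) (lin_coef_is_zmod_morphism k).

(** The Leibniz rule at the origin: a linear coefficient is the constant term of a partial
    derivative of a truncation. *)
Lemma lin_coefM k f g : lin_coef k (f * g) =
  lin_coef k f * mfps_const g + mfps_const f * lin_coef k g.
Proof.
have U2 : (mdeg (U_(k)%MM : 'X_{1..m}) < 2)%N by rewrite mdeg1.
rewrite /lin_coef [LHS](mfps_mulE f g U2) -[U_(k)%MM in LHS]add0m.
have dE (p : {mpoly R[m]}) : p@_(0 + U_(k)) = (p^`M(k))@_0.
  by rewrite mcoeff_mderiv mnm0E mulr1n.
rewrite dE mderivM mcoeffD !(rmorphM (mcoeff 0%MM)) /= -!dE add0m.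
by rewrite !mfps_truncE mdeg1 mdeg0.
Qed.

Lemma lin_coef1 k : lin_coef k 1 = 0.
Proof. by rewrite /lin_coef /= mnm1_eq0. Qed.

Definition mfps_var i : mfps m R := MFPS (fun a => (a == U_(i)%MM)%:R).

(** Multiplication by a variable shifts exponents; the case [a i == 0] is separate because
    subtraction of exponents is truncated. *)
Lemma mfps_varM i g a : (mfps_var i * g) a =
  if a i == 0%N then 0 else g (a - U_(i))%MM.
Proof.
rewrite mfps_coefM; case: eqVneq => [ai0|ai].
  rewrite big1 // => -[b c] /= /eqP ea; case: eqVneq => [eb|];
    last by rewrite mul0r.
  by have := congr1 (fun a : 'X_{1..m} => a i) ea;
    rewrite mnmDE eb mnm1E eqxx ai0.
have Ua : (U_(i) <= a)%MM by rewrite lep1mP.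
have ea : a = (U_(i) + (a - U_(i)))%MM by rewrite addmC submK.
have ad : (0 < mdeg a)%N by rewrite ea mdegD mdeg1.
rewrite -mfps_coefM mulrC [LHS](mfps_mulE _ _ (ltnSn _)).
have -> : mfps_trunc (mdeg a).+1 (mfps_var i) = 'X_[U_(i)].
  apply/mpolyP => b; rewrite mfps_truncE mcoeffX /= eq_sym.
  by case: ltnP => //; case: eqP => // <-; rewrite mdeg1 ltnNge ad.
have le_a : (mdeg (a - U_(i))%MM <= mdeg a)%N by rewrite [in leqRHS]ea mdegD
  leq_addl.
by rewrite [X in _@_X]ea mcoeffMX mfps_truncE ltnS le_a.
Qed.

Definition vanish d f := forall a, (mdeg a < d)%N -> f a = 0.

Lemma vanishM d e f g : vanish d f -> vanish e g -> vanish (d + e) (f * g).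
Proof.
move=> vf vg a ad; rewrite mfps_coefM big1 // => -[b c] /= /eqP ea.
case: (ltnP (mdeg b) d) => [/vf ->|db]; first by rewrite mul0r.
rewrite [g _]vg ?mulr0 // -(ltn_add2l d); apply: leq_ltn_trans ad.
by rewrite [X in (_ <= mdeg X)%N]ea mdegD leq_add2r.
Qed.

Lemma vanishX f d : aug_ideal f -> vanish d (f ^+ d).
Proof.
move=> f0; elim: d => [|d IH] //; rewrite exprS; apply: (vanishM (d := 1)) IH.
by move=> a; rewrite ltnS leqn0 mdeg_eq0 => /eqP ->.
Qed.

(** Terms of degree at least [d] do not reach lower coefficients of a product, so one coefficient
    can be computed with a partial sum in place of a series. *)
Lemma mfps_mul_coef_low f g h d a : (mdeg a < d)%N -> vanish d (g - h) ->
  (f * g) a = (f * h) a.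
Proof.
move=> ad vgh; apply/eqP; rewrite -subr_eq0; apply/eqP.
rewrite -[LHS]/((f * g - f * h) a) -mulrBr.
by apply: (vanishM (d := 0)) ad.
Qed.

(* The geometric series of [- f]; only finitely many powers contribute in each
   degree. *)
Definition mfps_geom f : mfps m R :=
  MFPS (fun a => (\sum_(i < (mdeg a).+1) (- f) ^+ i) a).

Lemma aug_ideal_in_radical : in_radical aug_ideal.
Proof.
move=> f f0; exists (mfps_geom f).
have nf0 : aug_ideal (- f) by rewrite /aug_ideal rmorphN /= f0 oppr0.
apply: mfpsP => a; set d := (mdeg a).+1.
(* Below degree [d] the series agrees with its first [d] terms; their product with [1 + f]
   telescopes to [1 - (- f) ^+ d], and the last power vanishes there. *)
rewrite (@mfps_mul_coef_low _ _ (\sum_(i < d) (- f) ^+ i) d) //; last first.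
  move=> b bd; rewrite -[LHS]/(mfps_geom f b - (\sum_(i < d) (- f) ^+ i) b).
  rewrite /= !mfps_coef_sum (big_ord_widen d (fun s : nat =>
    ((- f) ^+ s) b) bd).
  rewrite big_mkcond -sumrB big1 // => i _; case: ltnP => [_|bi];
    first exact: subrr.
  by rewrite (vanishX nf0) // subr0.
have -> : (1 + f) * \sum_(i < d) (- f) ^+ i = 1 - (- f) ^+ d.
  by rewrite -{1}[f]opprK -opprB mulNr -subrX1 opprB.
rewrite -[LHS]/((1 : mfps m R) a - ((- f) ^+ d) a) (vanishX nf0) ?subr0 //.
Qed.

(** Each monomial is assigned to the first variable dividing it, so [f] is a sum of
    [mfps_var i * s i]; the constant term of [s i] is 0 or a linear coefficient of [f], hence 0. *)
Lemma aug_ideal_sqP f : mfps_const f = 0 -> (forall k, lin_coef k f = 0) ->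
  ideal_sq aug_ideal f.
Proof.
move=> f0 f1.
have hI := ideal_sq_ideal aug_ideal_ideal.
pose s i : mfps m R := MFPS (fun c => let a := (c + U_(i))%MM in
   if [forall j : 'I_m, (j < i)%N ==> (a j == 0%N)] then f a else 0).
have -> : f = \sum_i mfps_var i * s i.
  apply: mfpsP => a; rewrite mfps_coef_sum.
  case: (eqVneq a 0%MM) => [->|nz].
    by rewrite big1 // => i _; rewrite mfps_varM mnm0E eqxx.
  have [i0 ai0] : exists i, a i != 0%N.
    apply/existsP; move: nz; apply: contraNT;
      rewrite negb_exists => /forallP a0.
    by apply/eqP/mnmP => i; rewrite mnm0E; apply/eqP; rewrite -[_ == _]negbK.
  (* The least index with nonzero exponent gives the only summand that contributes at [a]. *)
  case: (@arg_minnP _ i0 (fun i => a i != 0%N) (fun i => i : nat) ai0) =>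
    i ai imin.
  rewrite (eq_bigr _ (fun i _ => mfps_varM i (s i) a)) (bigD1 i) //.
  rewrite (negbTE ai) /= submK ?lep1mP // big1 ?addr0 => [|j nji].
    case: forallP => // -[] j; apply/implyP; rewrite ltnNge.
    by apply: contraR => /imin.
  case: eqVneq => //= aj; rewrite submK ?lep1mP //.
  case: forallP => // /(_ i); have := imin _ aj; rewrite leq_eqVlt.
  by rewrite val_eqE eq_sym (negbTE nji) /= => ->; rewrite (negbTE ai).
apply: ideal_sum => // i _; apply: ideal_sqM.
  by rewrite /aug_ideal /mfps_const /= eq_sym mnm1_eq0.
rewrite /aug_ideal /mfps_const /= add0m; case: ifP => // _; exact: f1.
Qed.
End PowerSeriesIdeal.

(** * First homology *)

Section FirstHomology.
Local Open Scope quotient_scope.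
Variable G : groupType.
Implicit Types (g h : G) (c : bar G 1).

(** Both faces of [[g]] are the empty tuple and occur with opposite signs, so every 1-chain is a
    cycle. *)
Lemma bar_boundary1 c : bar_boundary c = 0.
Proof.
rewrite -[c]freeg_sumE raddf_sum big1 // => x _ /=.
rewrite [LHS]liftU big_ord_recl big_ord1 !(tuple0 (bar_face _ _)).
by rewrite expr0 scale1r expr1 scaleN1r subrr scaler0.
Qed.

Definition cycle1 c : bar_cycles G 1 := MkCycle (introT eqP (bar_boundary1 c)).

Definition class1 c : group_homology G 1 := \pi_(group_homology G 1) (cycle1 c).

Fact class1_is_zmod_morphism : zmod_morphism class1.
Proof.
move=> c d; rewrite /class1 -raddfB; congr (\pi _); exact: val_inj.
Qed.
HB.instance Definition _ :=
  GRing.isZmodMorphism.Build (bar G 1) (group_homology G 1)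
  class1 class1_is_zmod_morphism.

Lemma class1_boundary (b : bar G 2) : class1 (bar_boundary b) = 0.
Proof.
apply/eqP; rewrite /class1 -[0](raddf0 (\pi_(group_homology G 1)))
  -Quotient.idealrBE subr0.
by apply/asboolP; exists b.
Qed.

Definition hclass g : group_homology G 1 := class1 << [tuple g] >>.

Lemma bar_boundary2 g h : bar_boundary (<< [tuple g; h] >> : bar G 2) =
  << [tuple h] >> - << [tuple (g * h)%g] >> + << [tuple g] >> :> bar G 1.
Proof.
rewrite [LHS]liftU scale1r !big_ord_recl big_ord0 addr0.
rewrite expr0 scale1r expr1 scaleN1r sqrrN expr1n scale1r addrA.
by congr (<< _ >> - << _ >> + << _ >>); apply: eq_from_tnth => j;
  rewrite (ord1 j) tnth_mktuple !(tnth_nth g).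
Qed.

Lemma hclassM g h : hclass (g * h)%g = hclass g + hclass h.
Proof.
have := class1_boundary << [tuple g; h] >>; rewrite bar_boundary2 raddfD raddfB.
by move/eqP; rewrite addrAC subr_eq0 addrC => /eqP.
Qed.

Lemma hclass1 : hclass 1%g = 0.
Proof. by apply: (addrI (hclass 1%g)); rewrite -hclassM mulg1 addr0. Qed.

Lemma hclassV g : hclass g^-1%g = - hclass g.
Proof. by apply: (addrI (hclass g)); rewrite -hclassM mulgV hclass1 subrr. Qed.

(** As [hclass] turns products into sums, an integral chain has the class of a product of powers,
    with inverses for negative coefficients. *)
Lemma hclass_surj (z : group_homology G 1) : exists g, z = hclass g.
Proof.
have imM n g : hclass g *+ n = hclass (g ^+ n)%g.
  by elim: n => [|n IH]; rewrite ?hclass1 // mulrS IH -hclassM expgS.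
have [c ->] : exists c, z = class1 c.
  exists (val (repr z)); rewrite -[LHS]reprK; congr (\pi _); exact: val_inj.
rewrite -[c]freeg_sumE raddf_sum; elim/big_rec: _ => [|x _ _ [g ->]].
  by exists 1%g; rewrite hclass1.
have ex : x = [tuple thead x] by rewrite [LHS]tuple_eta;
  congr [tuple of _ :: _]; rewrite [behead_tuple _]tuple0.
rewrite ex; case: (coeff _ c) => n;
  rewrite ?NegzE -?freegUN -[Posz _]natz -freegU_muln ?raddfN raddfMn.
  by exists ((thead x) ^+ n * g)%g; rewrite hclassM -imM.
by exists (((thead x) ^+ n.+1)^-1 * g)%g; rewrite hclassM hclassV -imM.
Qed.

(** A recognition criterion for the abelianization: [p] is onto, and every homomorphism to an
    abelian group kills its kernel. *)
Theorem H1_iso (V : zmodType) (p : G -> V) :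
  (forall g h, p (g * h)%g = p g + p h) -> (forall v, exists g, p g = v) ->
  (forall (W : zmodType) (q : G -> W), (forall g h, q (g * h)%g = q g + q h) ->
     forall g, p g = 0 -> q g = 0) ->
  zmod_iso (group_homology G 1) V.
Proof.
move=> pM psurj pker.
pose p1 (x : 1.-tuple G) : zmodule V := p (thead x).
pose P : bar G 1 -> V := fglift p1.
have PB c d : P (c - d) = P c - P d by exact: (lift_is_additive p1 c d).
pose PA := GRing.isZmodMorphism.Build _ _ P PB.
pose P' : {additive bar G 1 -> V} := HB.pack P PA.
have Pg g : P << [tuple g] >> = p g by rewrite /P liftU scale1r.
have Pb (b : bar G 2) : P (bar_boundary b) = 0.
  rewrite -[LHS]/((P' \o @bar_boundary G 2) b) -[b]freeg_sumE raddf_sum big1 //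
    => x _.
  rewrite -[coeff _ _]intz -freegU_mulz raddfMz.
  have [g [h ->]] : exists g h, x = [tuple g; h].
    by case: x => [[|g [|h []]] //= sx]; exists g, h; apply: val_inj.
  rewrite [X in X *~ _](_ : _ = 0) ?mul0rz //.
  rewrite -[LHS]/(P' (bar_boundary (<< [tuple g; h] >> : bar G 2)))
    bar_boundary2.
  by rewrite raddfD raddfB /= !Pg pM addrAC [p h + p g]addrC subrr.
pose f (z : group_homology G 1) : V := P (val (repr z)).
have fE c : f (class1 c) = P c.
  apply/eqP; rewrite -subr_eq0 -PB.
  have : (repr (class1 c) - cycle1 c) \in @bar_boundaries G 1.
    by rewrite Quotient.idealrBE reprK.
  by move=> /asboolP[b] /= ->; rewrite Pb.
have fg g : f (hclass g) = p g by rewrite fE Pg.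
have fD : zmod_morphism f.
  move=> x y; have [g ->] := hclass_surj x; have [h ->] := hclass_surj y.
  by rewrite -raddfB !fE PB.
pose FA := GRing.isZmodMorphism.Build _ _ f fD.
exists (HB.pack f FA : {additive _ -> _}) => /=.
have finj : injective f.
  move=> x y; have [g ->] := hclass_surj x; have [h ->] := hclass_surj y.
  rewrite !fg => pgh; apply/eqP; rewrite -subr_eq0 -hclassV -hclassM; apply/eqP.
  (* Injectivity is the kernel condition for the homomorphism [hclass] itself. *)
  apply: (pker _ hclass hclassM); rewrite pM pgh -pM mulgV.
  by apply: (addrI (p 1%g)); rewrite -pM mulg1 addr0.
have fsurj v : exists z, f z == v.
  by have [g <-] := psurj v; exists (hclass g); rewrite fg.
exists (fun v => xchoose (fsurj v)) => [z|v];
  last exact/eqP/(xchooseP (fsurj v)).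
by apply: finj; apply/eqP/(xchooseP (fsurj _)).
Qed.
End FirstHomology.

(** * Linear parts of congruence matrices *)

Arguments lin_coef : simpl never.
Arguments mfps_const : simpl never.

Section LinearPart.
Variables (m : nat) (R : comNzRingType) (n : nat).
Local Notation A := (mfps m R).
Local Notation aug := (@aug_ideal m R).
Implicit Types (M N : 'M[A]_n) (k : 'I_m).

Lemma congr_SL_const M i j : congr_SL aug M -> mfps_const (M i j) = (i == j)%:R.
Proof.
move=> [_ /(_ i j)]; rewrite /aug_ideal !mxE rmorphB /= => /eqP.
by rewrite subr_eq0 => /eqP ->; case: (i == j); rewrite ?rmorph1 ?rmorph0.
Qed.

Lemma congr_SL_augP M : \det M = 1 ->
  (forall i j, mfps_const (M i j) = (i == j)%:R) -> congr_SL aug M.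
Proof.
move=> dM cM; split=> // i j; rewrite /aug_ideal !mxE rmorphB /= cM.
by case: (i == j); rewrite ?rmorph1 ?rmorph0 subrr.
Qed.

Definition lin_part k M : 'M[R]_n := map_mx (lin_coef k) M.

(** Both constant parts are the identity, so each term of the Leibniz rule keeps only one linear
    part. *)
Lemma lin_partM k M N : congr_SL aug M -> congr_SL aug N ->
  lin_part k (M *m N) = lin_part k M + lin_part k N.
Proof.
move=> CM CN; apply/matrixP => i j; rewrite !mxE raddf_sum /=.
under eq_bigr => s _ do rewrite lin_coefM (congr_SL_const _ _ CM)
  (congr_SL_const _ _ CN).
rewrite big_split /=; congr (_ + _).
  rewrite (bigD1 j) //= eqxx mulr1 big1 ?addr0 // => s /negbTE ->; exact: mulr0.
rewrite (bigD1 i) //= eqxx mul1r big1 ?addr0 // => s /negbTE.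
by rewrite eq_sym => ->; exact: mul0r.
Qed.

(* Checked on the generators of elimination, this spares differentiating the
   determinant. *)
Lemma trace_lin_part k M : congr_SL aug M -> \tr (lin_part k M) = 0.
Proof.
move: M; apply: congr_SL_hom0;
  [exact: aug_ideal_ideal|exact: aug_ideal_in_radical| | |].
- by move=> M N CM CN; rewrite lin_partM // raddfD.
- move=> l v vl _; rewrite /mxtrace big1 // => i _.
  rewrite !mxE eqxx raddfD /= lin_coef1 add0r.
  by case: eqVneq => [->|_]; rewrite ?vl ?mulr0n raddf0.
- move=> i j u u' nij uu Iu;
  rewrite /mxtrace (bigD1 i) // (bigD1 j) 1?eq_sym //= big1.
    rewrite !mxE !eqxx !mulr1n addr0 [j == i]eq_sym (negbTE nij).
    have cu : mfps_const u = 1.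
      by move: Iu; rewrite /aug_ideal rmorphB /= rmorph1 => /eqP;
        rewrite subr_eq0 => /eqP.
    have cu' : mfps_const u' = 1.
      by have := congr1 (@mfps_const m R) uu;
        rewrite rmorphM rmorph1 /= cu mul1r.
    by have := congr1 (lin_coef k) uu;
      rewrite lin_coefM lin_coef1 cu cu' mulr1 mul1r.
  by move=> s /andP[/negbTE ni /negbTE nj];
    rewrite !mxE eqxx ni nj mulr1n lin_coef1.
Qed.

Lemma lin_part_sq M : congr_SL aug M -> (forall k, lin_part k M = 0) ->
  congr_SL (ideal_sq aug) M.
Proof.
move=> CM lM; split=> [|i j]; first exact: CM.1.
apply: aug_ideal_sqP => [|k]; first exact: CM.2.
rewrite !mxE raddfB /=; have /matrixP/(_ i j) := lM k; rewrite !mxE => ->.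
by case: (i == j); rewrite ?mulr1n ?mulr0n ?lin_coef1 ?(raddf0 (lin_coef k))
  subr0.
Qed.

(* Scaling a row of [1 + sum_k t_k X_k] makes its determinant 1; the linear part
   is unchanged, since it has trace zero both before and after. *)
Lemma lin_part_surj (X : 'I_m -> 'M[R]_n) : (0 < n)%N ->
  (forall k, \tr (X k) = 0) ->
  exists2 M, congr_SL aug M & forall k, lin_part k M = X k.
Proof.
move=> n0 trX; pose i0 := Ordinal n0.
pose M : 'M[A]_n := \matrix_(i, j) MFPS (fun a : 'X_{1..m} =>
  if a == 0%MM then (i == j)%:R else \sum_k X k i j *+ (a == U_(k)%MM)).
have cM i j : mfps_const (M i j) =
  (i == j)%:R by rewrite /mfps_const mxE /= eqxx.
have lM k : lin_part k M = X k.
  apply/matrixP => i j; rewrite !mxE /lin_coef /= mnm1_eq0 (bigD1 k) //= eqxx.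
  by rewrite big1 ?addr0 // => l nlk; rewrite eq_mnm1 eq_sym (negbTE nlk).
have cd : mfps_const (\det M) = 1.
  rewrite -det_map_mx (_ : map_mx _ _ = 1%:M) ?det1 //.
  by apply/matrixP => i j; rewrite mxE [RHS]mxE; exact: cM.
have Id : aug (\det M - 1) by rewrite /aug_ideal rmorphB rmorph1 /= cd subrr.
have [y] := aug_ideal_in_radical Id; rewrite addrC subrK => dy.
have cy : mfps_const y = 1.
  by have := congr1 (@mfps_const m R) dy; rewrite rmorphM rmorph1 /= cd mul1r.
pose D : 'rV[A]_n := \row_j if j == i0 then y else 1.
have dD : \det (diag_mx D) = y.
  rewrite det_diag (bigD1 i0) //= mxE eqxx big1 ?mulr1 // => i.
  by rewrite mxE => /negbTE ->.
have cD i : mfps_const (D 0 i) = 1 by rewrite mxE; case: ifP => // _;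
  rewrite rmorph1.
(* As [M] has constant part 1, scaling row [i0] by [y] changes the linear part only at the entry
   [(i0, i0)]. *)
have lDM k i j : lin_part k (diag_mx D *m M) i j =
    X k i j + (lin_coef k y) *+ ((i == j) && (i == i0)).
  rewrite mul_diag_mx mxE [X in lin_coef k X]mxE lin_coefM cD mul1r cM addrC.
  have /matrixP/(_ i j) := lM k; rewrite !mxE => ->; congr (_ + _).
  by case: (i == j); case: (i == i0);
    rewrite ?mulr1 ?mulr0 ?lin_coef1 ?mul0r ?mulr1n.
have CDM : congr_SL aug (diag_mx D *m M).
  apply: congr_SL_augP; first by rewrite det_mulmx dD mulrC.
  by move=> i j; rewrite mul_diag_mx mxE rmorphM /= cD mul1r cM.
exists (diag_mx D *m M) => // k; apply/matrixP => i j; rewrite lDM.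
suff -> : lin_coef k y = 0 by rewrite mul0rn addr0.
have := trace_lin_part k CDM; rewrite /mxtrace.
under eq_bigr do rewrite lDM eqxx.
rewrite big_split /= -/(mxtrace (X k)) trX add0r (bigD1 i0) //= ?eqxx big1
  ?addr0 //.
by move=> s /negbTE ->.
Qed.

End LinearPart.

(** * The congruence group and its first homology *)

Section CongruenceGroup.
Variables (F : fieldType) (n m : nat).
Local Notation C := (congSL F n m).
Local Notation A := (mfps m F).
Local Notation aug := (@aug_ideal m F).
Implicit Types (g h : C) (M N : 'M[A]_n).

Definition congSL_mx g : 'M[A]_n := SLval (group_ker_val g).

Lemma congSL_mxM g h : congSL_mx (g * h)%g = congSL_mx g *m congSL_mx h.
Proof. by []. Qed.

Lemma congSL_mx_inj : injective congSL_mx.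
Proof. by move=> g h /val_inj/val_inj. Qed.

Lemma congSL_mx_congr g : congr_SL aug (congSL_mx g).
Proof.
apply: congr_SL_augP; first exact: SL_det.
move=> i j; have /eqP/(congr1 (@SLval _ _))/matrixP/(_ i j) := valP g.
by rewrite !mxE.
Qed.

(** The value defaults to the identity off the congruence matrices, so that a map on [C] gives a
    function of all matrices. *)
Definition mx_congSL M : C := insubd (1%g : C) (insubd (1%g : SL n A) M).

Lemma mx_congSLK M : congr_SL aug M -> congSL_mx (mx_congSL M) = M.
Proof.
move=> CM; have dM : \det M == 1 by apply/eqP; exact: CM.1.
have vM : SLval (insubd (1%g : SL n A) M) = M.
  by rewrite -[LHS]/(val _) val_insubd dM.
have cM : SL_map n (@mfps_const m F) (insubd (1%g : SL n A) M) == 1%g.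
  apply/eqP/val_inj/matrixP => i j; rewrite /= vM mxE [RHS]mxE.
  exact: congr_SL_const.
by rewrite /congSL_mx /mx_congSL -[group_ker_val _]/(val _) val_insubd cM.
Qed.

Lemma mx_congSLM M N : congr_SL aug M -> congr_SL aug N ->
  mx_congSL (M *m N) = (mx_congSL M * mx_congSL N)%g.
Proof.
move=> CM CN; apply: congSL_mx_inj; rewrite congSL_mxM !mx_congSLK //.
exact: congr_SL_mul (aug_ideal_ideal _ _) CM CN.
Qed.

Fact congSL_lin_proof g k : \tr (lin_part k (congSL_mx g)) == 0.
Proof. by apply/eqP/trace_lin_part/congSL_mx_congr. Qed.

Definition congSL_lin g : {ffun 'I_m -> sl n F} :=
  [ffun k => MkSl (congSL_lin_proof g k)].

Lemma H1_congSL : (0 < n)%N ->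
  (2%:R != 0 :> F) || (3 <= n)%N ->
  zmod_iso (group_homology C 1) {ffun 'I_m -> sl n F}.
Proof.
move=> n0 hn; apply: (@H1_iso _ _ congSL_lin).
- move=> g h; apply/ffunP => k; rewrite !ffunE; apply: val_inj => /=.
  by rewrite congSL_mxM lin_partM //; exact: congSL_mx_congr.
- move=> v; have trv k : \tr (v k) = 0 by apply/eqP; exact: (valP (v k)).
  have [M CM lM] := lin_part_surj n0 trv.
  exists (mx_congSL M); apply/ffunP => k; rewrite ffunE; apply: val_inj => /=.
  by rewrite mx_congSLK.
move=> W q qM g pg.
have CJ : congr_SL (ideal_sq aug) (congSL_mx g).
  apply: lin_part_sq; first exact: congSL_mx_congr.
  by move=> k; move/ffunP/(_ k)/(congr1 (@sl_val _ _)): (pg); rewrite !ffunE.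
(* Transport [q] to matrices, where the vanishing on the square of the ideal is available. *)
pose Q M := q (mx_congSL M).
have QM M N : congr_SL aug M -> congr_SL aug N -> Q (M *m N) = Q M + Q N.
  by move=> CM CN; rewrite /Q mx_congSLM.
have hI := aug_ideal_ideal m F; have hrad := @aug_ideal_in_radical m F.
have <- : Q (congSL_mx g) = q g.
  by congr q; apply: congSL_mx_inj; rewrite mx_congSLK //;
    exact: congSL_mx_congr.
apply: (hom_congr_SL_sq0 hI hrad QM) => // i j a b nij Ia Ib.
case: (boolP (3 <= n)%N) hn => [n3 _|_]; first exact: (hom_elem3 hI QM).
rewrite orbF => h2.
(* The constant series 1/2. *)
pose h : A := MFPS (fun a : 'X_{1..m} => (a == 0%MM)%:R / 2%:R).
apply: (@hom_elem2 _ _ aug _ Q hI hrad QM i j a b h) => //.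
rewrite mulr_natl; apply: mfpsP => c; rewrite -[LHS]/(h c + h c) /= -mulrDl.
by case: (c == 0%MM); rewrite ?addr0 ?mul0r // -[1 + 1]/2%:R divff.
Qed.
End CongruenceGroup.

Theorem mainTheorem2 (F : fieldType) (m : nat) (hm : (1 <= m)%N) :
  (forall n : nat, (3 <= n)%N ->
     zmod_iso (group_homology (congSL F n m) 1) {ffun 'I_m -> sl n F}) /\
  ((2 \notin [pchar F])%N -> ~ field_iso F 'F_3 ->
     zmod_iso (group_homology (congSL F 2 m) 1) {ffun 'I_m -> sl 2 F}).
Proof.
split=> [n n3|n2 _]; apply: H1_congSL => //.
- exact: ltn_trans n3.
- by rewrite n3 orbT.
(* As 2 is prime, not being the characteristic means that it is nonzero in [F]. *)
by move: n2; rewrite !inE orbF.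
Qed.
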